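(* For any $\lambda\in\mathcal G(H)$, the quintuple $(H,\cdot_\lambda,\emptyset,\Delta_\lambda,\varepsilon_\lambda)$ is a Hopf algebra, where $$A\cdot_\lambda B:=\phi_\lambda^{-1}\big(\phi_\lambda(A)\cdot\phi_\lambda(B)\big),\qquad \Delta_\lambda A:=(\phi_\lambda^{-1}\otimes\phi_\lambda^{-1})\Delta\phi_\lambda A,\qquad \varepsilon_\lambda(A):=\varepsilon\circ\phi_\lambda(A)=\lambda(A)$$ for $A,B\in H$. Moreover the map $$\phi_\lambda^{-1}:(H,\cdot,\emptyset,\Delta,\varepsilon)\to(H,\cdot_\lambda,\emptyset,\Delta_\lambda,\varepsilon_\lambda)$$ is an isomorphism of Hopf algebras.
   Context: Let $\mathcal A$ be a set and $\mathcal M(\mathcal A)\subset\mathbb{N}^{\mathcal A}$ the set of finitely supported functions $B:\mathcal A\to\mathbb{N}=\{0,1,2,\dots\}$, a commutative monoid for $(A\cdot B)(a):=A(a)+B(a)$ with neutral element the zero function $\emptyset$. $H$ is the real vector space freely generated by $\mathcal M(\mathcal A)$, with the bilinear extension of $\cdot$ as product, unit $\emptyset$, coproduct $$\Delta A:=\sum_{B_1,B_2\in\mathcal M(\mathcal A),\ B_1\cdot B_2=A}\ \prod_{a\in\mathcal A}\frac{A(a)!}{B_1(a)!\,B_2(a)!}\;B_1\otimes B_2,\qquad A\in\mathcal M(\mathcal A),$$ and counit $\varepsilon(A)=\mathbf 1_{(A=\emptyset)}$ for $A\in\mathcal M(\mathcal A)$; this is a commutative and cocommutative Hopf algebra. On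 the dual $H^*$, $(f\star g)(A):=(f\otimes g)\Delta A$. The set $\mathcal G(H):=\{\lambda\in H^*:\lambda(\emptyset)=1\}$ is a group for $\star$ with unit $\varepsilon$. For $\lambda\in\mathcal G(H)$, $\phi_\lambda:H\to H$ is the linear map $\phi_\lambda(A):=(\lambda\otimes\mathrm{id})\Delta A$; it is invertible, with $\phi_\lambda^{-1}=\phi_{\lambda^{-1}}$, where $\lambda^{-1}$ is the $\star$-inverse of $\lambda$. *)

(* Defs.v *)
From HB Require Import structures.
From mathcomp Require Import all_boot all_order all_algebra.
From mathcomp Require Import finmap.
From mathcomp Require Import all_classical reals.
From mathcomp.multinomials Require Import monalg.

Set Implicit Arguments.
Unset Strict Implicit.
Unset Printing Implicit Defensive.

Import GRing.Theory.

Local Open Scope ring_scope.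
Local Open Scope classical_set_scope.

(* [{malg R[K]}] is the vector space freely generated by [K].  The tensor     *)
(* product of the spaces freely generated by [K] and [L] is the one freely    *)
(* generated by [K * L]; its universal property is [tens_liftE] and           *)
(* [tens_lift_uniq].                                                          *)
Notation tensor R K L := {malg R[(K * L)%type]}.

Section Tensor.
Context {R : fieldType}.

Definition lin_ext {K : choiceType} {V : lmodType R} (f : K -> V)
    (u : {malg R[K]}) : V :=
  \sum_(k <- msupp u) u@_k *: f k.

Definition tens {K L : choiceType} (u : {malg R[K]}) (v : {malg R[L]}) :
    tensor R K L :=
  lin_ext (fun k => lin_ext (fun l => << (k, l) >>) v) u.

Definition bilinear {U V W : lmodType R} (b : U -> V -> W) : Prop :=
  (forall u, linear (b u)) /\ (forall v, linear (b^~ v)).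

Definition tens_lift {K L : choiceType} {V : lmodType R}
    (b : {malg R[K]} -> {malg R[L]} -> V) : tensor R K L -> V :=
  lin_ext (fun p => b << p.1 >> << p.2 >>).

Definition tens_map {K L K' L' : choiceType}
    (f : {malg R[K]} -> {malg R[K']}) (g : {malg R[L]} -> {malg R[L']}) :
    tensor R K L -> tensor R K' L' :=
  tens_lift (fun u v => tens (f u) (g v)).

Definition tens_assoc {K L M : choiceType} :
    tensor R (K * L)%type M -> tensor R K (L * M)%type :=
  tens_lift (fun t w => tens_lift (fun u v => tens u (tens v w)) t).

Definition tens_mul {K : choiceType}
    (mul : {malg R[K]} -> {malg R[K]} -> {malg R[K]}) :
    tensor R K K -> tensor R K K -> tensor R K K :=
  fun s t =>
    tens_lift (fun a b => tens_lift (fun c d => tens (mul a c) (mul b d)) t) s.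

Section LinExt.
Context {K : choiceType} {V : lmodType R}.
Implicit Types (f : K -> V) (u v : {malg R[K]}).

Lemma lin_ext_sub f u (d : {fset K}) : (msupp u `<=` d)%fset ->
  lin_ext f u = \sum_(k <- d) u@_k *: f k.
Proof.
move=> le_d; rewrite /lin_ext (big_fset_incl _ le_d) //= => k _.
by rewrite -mcoeff_eq0 => /eqP->; rewrite scale0r.
Qed.

Lemma lin_ext_linear f : linear (lin_ext f).
Proof.
move=> a u v.
pose d := (msupp u `|` msupp v `|` msupp (a *: u + v))%fset.
rewrite !(@lin_ext_sub _ _ d) /d.
- rewrite scaler_sumr -big_split /=; apply: eq_bigr => k _.
  by rewrite mcoeffD mcoeffZ scalerDl scalerA.
- by rewrite -fsetUA (fsubset_trans _ (fsubsetUr _ _)) ?fsubsetUl.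
- by rewrite -fsetUA fsubsetUl.
- exact: fsubsetUr.
Qed.

Lemma lin_extU f k : lin_ext f << k >> = f k.
Proof.
rewrite (@lin_ext_sub _ _ [fset k]%fset) ?msuppU_le //.
by rewrite big_seq_fset1 mcoeffU eqxx scale1r.
Qed.

Lemma lin_ext_uniq (g : {malg R[K]} -> V) f : linear g ->
  (forall k, g << k >> = f k) -> g =1 lin_ext f.
Proof.
move=> lin_g gE u.
pose gL : {linear {malg R[K]} -> V} :=
  HB.pack g (GRing.isLinear.Build _ _ _ _ g lin_g).
rewrite -[g u]/(gL u) {1}[u]monalgE raddf_sum; apply: eq_bigr => k _.
have -> : << u@_k *g k >> = u@_k *: (<< k >> : {malg R[K]}).
  by apply/malgP => l; rewrite mcoeffZ !mcoeffU mulr_natr.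
by rewrite -gE; exact: (linearZZ gL).
Qed.
End LinExt.

Section TensTheory.
Context {K L : choiceType} {V : lmodType R}.
Implicit Types (b : {malg R[K]} -> {malg R[L]} -> V).

Lemma tens_bilinear : bilinear (@tens K L).
Proof.
split=> [u a v w|v]; last exact: lin_ext_linear.
rewrite /tens /lin_ext scaler_sumr -big_split /=; apply: eq_bigr => k _.
by rewrite [\sum_(_ <- _) _](lin_ext_linear _ a v w) scalerDr !scalerA mulrC.
Qed.

Lemma tensUU k l : tens << k >> << l >> = << (k, l) >> :> tensor R K L.
Proof. by rewrite /tens !lin_extU. Qed.

Lemma tens_lift_linear b : linear (tens_lift b).
Proof. exact: lin_ext_linear. Qed.

Lemma tens_liftE b u v : bilinear b -> tens_lift b (tens u v) = b u v.
Proof.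
case=> linr linl; have [tlinr tlinl] := tens_bilinear.
have tl := tens_lift_linear b.
transitivity (lin_ext (fun k => b << k >> v) u); last first.
  by rewrite -(lin_ext_uniq (linl v) (fun=> erefl)).
apply: (lin_ext_uniq (g := fun x => tens_lift b (tens x v))) => [a x y|k].
  by rewrite tlinl tl.
transitivity (lin_ext (fun l => b << k >> << l >>) v); last first.
  by rewrite -(lin_ext_uniq (linr _) (fun=> erefl)).
apply: (lin_ext_uniq (g := fun x => tens_lift b (tens << k >> x))).
  by move=> a x y; rewrite tlinr tl.
by move=> l; rewrite tensUU /tens_lift lin_extU.
Qed.

Lemma tens_lift_uniq b (g : tensor R K L -> V) : linear g ->
  (forall u v, g (tens u v) = b u v) -> g =1 tens_lift b.
Proof.
by move=> lin_g gE; apply: lin_ext_uniq => // -[k l]; rewrite -tensUU gE.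
Qed.
End TensTheory.
End Tensor.

Section Hopf.
Context {R : fieldType}.

Record bialgebra_data (K : choiceType) := BialgebraData {
  bmul : {malg R[K]} -> {malg R[K]} -> {malg R[K]};
  bunit : {malg R[K]};
  bcomul : {malg R[K]} -> tensor R K K;
  bcounit : {malg R[K]} -> R
}.

Record is_algebra {K : choiceType} (B : bialgebra_data K) : Prop := IsAlgebra {
  bmul_bilinear : bilinear (bmul B);
  bmulA : associative (bmul B);
  bmul1 : left_id (bunit B) (bmul B);
  b1mul : right_id (bunit B) (bmul B)
}.

Record is_coalgebra {K : choiceType} (B : bialgebra_data K) : Prop :=
IsCoalgebra {
  bcomul_linear : linear (bcomul B);
  bcounit_linear : scalar (bcounit B);
  bcomulA : forall x,
    tens_assoc (tens_map (bcomul B) id (bcomul B x)) =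
    tens_map id (bcomul B) (bcomul B x);
  bcounitl : forall x,
    tens_lift (fun u v => bcounit B u *: v) (bcomul B x) = x;
  bcounitr : forall x,
    tens_lift (fun u v => bcounit B v *: u) (bcomul B x) = x
}.

Record is_bialgebra {K : choiceType} (B : bialgebra_data K) : Prop :=
IsBialgebra {
  bialgebra_algebra : is_algebra B;
  bialgebra_coalgebra : is_coalgebra B;
  bcomulM : forall x y,
    bcomul B (bmul B x y) = tens_mul (bmul B) (bcomul B x) (bcomul B y);
  bcomul1 : bcomul B (bunit B) = tens (bunit B) (bunit B);
  bcounitM : {morph bcounit B : x y / bmul B x y >-> x * y};
  bcounit1 : bcounit B (bunit B) = 1
}.

Record is_antipode {K : choiceType} (B : bialgebra_data K)
    (S : {malg R[K]} -> {malg R[K]}) : Prop := IsAntipode {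
  antipode_linear : linear S;
  antipodel : forall x,
    tens_lift (fun u v => bmul B (S u) v) (bcomul B x) =
    bcounit B x *: bunit B;
  antipoder : forall x,
    tens_lift (fun u v => bmul B u (S v)) (bcomul B x) =
    bcounit B x *: bunit B
}.

Definition is_hopf {K : choiceType} (B : bialgebra_data K) : Prop :=
  is_bialgebra B /\ exists S, is_antipode B S.

Record is_hopf_iso {K L : choiceType} (B : bialgebra_data K)
    (C : bialgebra_data L) (f : {malg R[K]} -> {malg R[L]}) : Prop :=
IsHopfIso {
  hopf_iso_dom : is_hopf B;
  hopf_iso_codom : is_hopf C;
  hopf_iso_linear : linear f;
  hopf_iso_bij : bijective f;
  hopf_isoM : {morph f : x y / bmul B x y >-> bmul C x y};
  hopf_iso1 : f (bunit B) = bunit C;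
  hopf_iso_comul : forall x, bcomul C (f x) = tens_map f f (bcomul B x);
  hopf_iso_counit : forall x, bcounit C (f x) = bcounit B x;
  hopf_iso_antipode : forall S T, is_antipode B S -> is_antipode C T ->
    forall x, f (S x) = T (f x)
}.
End Hopf.

Section Deformation.
Context (R : realType) (A : choiceType).

(* [{cmonom A}] is the monoid of finitely supported functions [A -> nat], and *)
(* the ring product of [{malg R[{cmonom A}]}] is the bilinear extension of    *)
(* its product, with unit [1 = << mone >>].                                    *)
Notation M := {cmonom A}.
Notation H := {malg R[M]}.

(* The factors outside the supports are equal to 1, and the set of pairs in   *)
(* [comul_monom] is finite, so both big operators have finite support.        *)
Definition coeff_monom (m m1 m2 : M) : R :=
  \big[*%R/1]_(a \in [set: A]) ((m a)`!%:R / ((m1 a)`!%:R * (m2 a)`!%:R) : R).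

Definition comul_monom (m : M) : tensor R M M :=
  \sum_(p \in [set p : M * M | mmul p.1 p.2 = m])
    coeff_monom m p.1 p.2 *: tens (<< p.1 >> : H) (<< p.2 >> : H).

Definition comul : H -> tensor R M M := lin_ext comul_monom.

Definition counit : H -> R := lin_ext (V := R^o) (fun m : M => (m == mone)%:R).

Definition hopfH : bialgebra_data M := BialgebraData *%R 1 comul counit.

Definition phi (lam : {scalar H}) (x : H) : H :=
  tens_lift (fun u v => lam u *: v) (comul x).

(* [phi lam] is bijective when [lam 1 = 1].                                   *)
Definition phi_inv (lam : {scalar H}) : H -> H :=
  'pinv_(fun=> 0) [set: H] (phi lam).

Definition mul_lam (lam : {scalar H}) (x y : H) : H :=
  phi_inv lam (phi lam x * phi lam y).

Definition comul_lam (lam : {scalar H}) (x : H) : tensor R M M :=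
  tens_map (phi_inv lam) (phi_inv lam) (comul (phi lam x)).

Definition counit_lam (lam : {scalar H}) (x : H) : R := counit (phi lam x).

Definition hopfH_lam (lam : {scalar H}) : bialgebra_data M :=
  BialgebraData (mul_lam lam) 1 (comul_lam lam) (counit_lam lam).
End Deformation.

(* Main.v *)
Require Import Defs.
From HB Require Import structures.
From mathcomp Require Import all_boot all_order all_algebra.
From mathcomp Require Import finmap all_classical reals.
From mathcomp.multinomials Require Import monalg.
From mathcomp Require Import ring.

(* The three assertions are a transport of structure along [phi lam], so two  *)
(* facts are needed: [H] itself is a Hopf algebra, and [phi lam] is bijective.*)
(* Pascal's rule for the coefficients gives                                   *)
(* [comul (m a) = comul m * (a (x) 1 + 1 (x) a)] for a generator [a]; hence   *)
(* [comul] is an algebra morphism, and each axiom of [H] is an equality of    *)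
(* unital algebra morphisms which only has to be tested on generators.  The   *)
(* same rule gives                                                            *)
(* [phi l (m a) = phi l m * a + phi (fun u => l (u a)) m], so that            *)
(* [phi l m = l 1 *: m] up to terms of lower degree, by induction on [m] for  *)
(* all linear forms [l] at once: [phi lam] is unipotent for the degree        *)
(* filtration.  Antipodes correspond because a bialgebra has at most one.     *)

Set Implicit Arguments.
Unset Strict Implicit.
Unset Printing Implicit Defensive.

Import GRing.Theory Num.Theory.
(* [bilinear] of MathComp would otherwise hide the one of [Defs].             *)
Import Defs.

Local Open Scope ring_scope.
Local Open Scope classical_set_scope.

(** * Tensor calculus and transport of Hopf structures *)

(** [H] is the polynomial algebra on [A], and the weights in [comul_monom] are exactly those for
    which [comul] is the algebra morphism making every generator primitive. This is [comul_monomM],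
    a coefficientwise Pascal rule. By [eq_algmor] the counit, antipode and coassociativity
    identities then reduce to generators, which gives [hopfH_is_hopf] with antipode a -> -a. The map
    [phi lam] is not multiplicative in general, so its bijectivity needs another argument.
    Contracting Δ(x a) = Δ(x)(a ⊗ 1 + 1 ⊗ a) with a form l gives [contract_mulU], a recursion in
    which the form changes to u -> l(u a). Hence contraction never raises degree, and its top part
    on a monomial m is l(1) m ([contract_top]). With [lam 1 = 1] the map [phi lam] is the identity
    modulo lower degree, hence bijective ([unipotent_bijective]); the convolution inverse of [lam]
    is not constructed. The deformed structure is then that of [H] read through [phi lam], and
    [transport_hopf_iso] concludes; arbitrary antipodes are matched by [antipode_uniq]. *)

Section TensorCalculus.
Context {R : fieldType}.

Lemma linear_raddf0 (U V : lmodType R) (f : U -> V) : linear f -> f 0 = 0.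
Proof.
by move=> lf; have := lf (-1) 0 0; rewrite scaler0 addr0 scaleN1r addNr.
Qed.

Lemma linear_scaleE (U V : lmodType R) (f : U -> V) a u :
  linear f -> f (a *: u) = a *: f u.
Proof. by move=> lf; have := lf a u 0; rewrite (linear_raddf0 lf) !addr0. Qed.

Lemma linear_addE (U V : lmodType R) (f : U -> V) u v :
  linear f -> f (u + v) = f u + f v.
Proof. by move=> lf; have := lf 1 u v; rewrite !scale1r. Qed.

Lemma linear_comp (U V W : lmodType R) (f : V -> W) (g : U -> V) :
  linear f -> linear g -> linear (f \o g).
Proof. by move=> lf lg a u v /=; rewrite lg lf. Qed.

Lemma linear_id (U : lmodType R) : linear (@id U).
Proof. by []. Qed.

Lemma linear_can (U V : lmodType R) (f : U -> V) (g : V -> U) :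
  linear f -> cancel f g -> cancel g f -> linear g.
Proof. by move=> lf fK gK a u v; rewrite -{1}(gK u) -{1}(gK v) -lf fK. Qed.

Lemma eq_malg_linear (K : choiceType) (V : lmodType R)
    (f g : {malg R[K]} -> V) :
  linear f -> linear g -> (forall k, f << k >> = g << k >>) -> f =1 g.
Proof.
move=> lf lg fg x.
by rewrite (lin_ext_uniq lf fg) -(lin_ext_uniq lg (fun=> erefl)).
Qed.

Lemma linear_lin_ext (K : choiceType) (V W : lmodType R) (h : V -> W)
    (f : K -> V) t : linear h -> h (lin_ext f t) = lin_ext (h \o f) t.
Proof.
move=> lh; apply: (lin_ext_uniq (g := h \o lin_ext f)) => [|k] /=.
  exact: linear_comp lh (lin_ext_linear _).
by rewrite lin_extU.
Qed.

Lemma linear_tens_lift (K L : choiceType) (V W : lmodType R) (h : V -> W)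
    (b : {malg R[K]} -> {malg R[L]} -> V) t :
  linear h -> h (tens_lift b t) = tens_lift (fun u v => h (b u v)) t.
Proof. exact: linear_lin_ext. Qed.

Lemma eq_tens_lift (K L : choiceType) (V : lmodType R)
    (b c : {malg R[K]} -> {malg R[L]} -> V) t :
  (forall u v, b u v = c u v) -> tens_lift b t = tens_lift c t.
Proof. by move=> bc; apply: eq_bigr => -[k l] _; rewrite bc. Qed.

Lemma tens_lift_map (K L K' L' : choiceType) (V : lmodType R)
    (f : {malg R[K]} -> {malg R[K']}) (g : {malg R[L]} -> {malg R[L']})
    (b : {malg R[K']} -> {malg R[L']} -> V) t : bilinear b ->
  tens_lift b (tens_map f g t) = tens_lift (fun u v => b (f u) (g v)) t.
Proof.
move=> lb; rewrite /tens_map (linear_tens_lift _ _ (tens_lift_linear b)).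
by apply: eq_tens_lift => u v; rewrite tens_liftE.
Qed.

Lemma tens_linl (K L : choiceType) (v : {malg R[L]}) :
  linear (fun u : {malg R[K]} => tens u v).
Proof. by case: (@tens_bilinear R K L). Qed.

Lemma tens_linr (K L : choiceType) (u : {malg R[K]}) :
  linear (fun v : {malg R[L]} => tens u v).
Proof. by case: (@tens_bilinear R K L). Qed.

(** The sum runs over the support of the fixed tensor [t], so linearity holds term by term. Nested
    lifts become bilinear this way. *)
Lemma tens_lift_param (K L : choiceType) (U V : lmodType R)
    (b : U -> {malg R[K]} -> {malg R[L]} -> V) t :
  (forall u v, linear (fun x => b x u v)) ->
  linear (fun x => tens_lift (b x) t).
Proof.
move=> lb a x y; rewrite /tens_lift /lin_ext scaler_sumr -big_split /=.
by apply: eq_bigr => p _; rewrite lb scalerDr !scalerA mulrC.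
Qed.

Lemma bilinear_tens_map (K L K' L' : choiceType)
    (f : {malg R[K]} -> {malg R[K']}) (g : {malg R[L]} -> {malg R[L']}) :
  linear f -> linear g -> bilinear (fun u v => tens (f u) (g v)).
Proof.
move=> lf lg; split=> [u a v w|v a u w]; first by rewrite lg tens_linr.
by rewrite lf tens_linl.
Qed.

Lemma tens_mapE (K L K' L' : choiceType)
    (f : {malg R[K]} -> {malg R[K']}) (g : {malg R[L]} -> {malg R[L']}) u v :
  linear f -> linear g -> tens_map f g (tens u v) = tens (f u) (g v).
Proof.
by move=> lf lg; rewrite /tens_map tens_liftE //; exact: bilinear_tens_map.
Qed.

Lemma tens_map_linear (K L K' L' : choiceType)
    (f : {malg R[K]} -> {malg R[K']}) (g : {malg R[L]} -> {malg R[L']}) :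
  linear (tens_map f g).
Proof. by move=> ? ? ?; rewrite /tens_map tens_lift_linear. Qed.

Lemma tens_map_comp (K L K' L' K'' L'' : choiceType)
    (f : {malg R[K']} -> {malg R[K'']}) (g : {malg R[L']} -> {malg R[L'']})
    (f' : {malg R[K]} -> {malg R[K']}) (g' : {malg R[L]} -> {malg R[L']}) t :
  linear f -> linear g ->
  tens_map f g (tens_map f' g' t) = tens_map (f \o f') (g \o g') t.
Proof.
by move=> lf lg; rewrite /tens_map tens_lift_map //; exact: bilinear_tens_map.
Qed.

Lemma eq_tens_map (K L K' L' : choiceType)
    (f f' : {malg R[K]} -> {malg R[K']})
    (g g' : {malg R[L]} -> {malg R[L']}) t :
  f =1 f' -> g =1 g' -> tens_map f g t = tens_map f' g' t.
Proof. by move=> ff' gg'; apply: eq_tens_lift => u v; rewrite ff' gg'. Qed.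

Lemma eq_tens_linear (K L : choiceType) (V : lmodType R)
    (f g : tensor R K L -> V) :
  linear f -> linear g -> (forall u v, f (tens u v) = g (tens u v)) -> f =1 g.
Proof.
move=> lf lg fg t.
by rewrite (tens_lift_uniq lf fg) -(tens_lift_uniq lg (fun _ _ => erefl)).
Qed.

Lemma tens_assocE (K L M : choiceType)
    (u : {malg R[K]}) (v : {malg R[L]}) (w : {malg R[M]}) :
  tens_assoc (tens (tens u v) w) = tens u (tens v w).
Proof.
have lb w' : bilinear (fun (u : {malg R[K]}) (v : {malg R[L]}) =>
    tens u (tens v (w' : {malg R[M]}))).
  by split=> [? ? ? ?|? ? ? ?]; rewrite ?tens_linl ?tens_linr.
rewrite /tens_assoc tens_liftE ?tens_liftE //; split=> [t|w'].
  by apply: tens_lift_param => ? ? ? ? ?; rewrite !tens_linr.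
by move=> ? ? ?; rewrite tens_lift_linear.
Qed.

Lemma tens_assoc_linear (K L M : choiceType) : linear (@tens_assoc R K L M).
Proof. by move=> ? ? ?; rewrite /tens_assoc tens_lift_linear. Qed.

Lemma tens_assoc_nat (K L M K' L' M' : choiceType)
    (f : {malg R[K]} -> {malg R[K']}) (g : {malg R[L]} -> {malg R[L']})
    (h : {malg R[M]} -> {malg R[M']}) t : linear f -> linear g -> linear h ->
  tens_assoc (tens_map (tens_map f g) h t) =
  tens_map f (tens_map g h) (tens_assoc t).
Proof.
move=> lf lg lh; have lm := @tens_map_linear; have la := @tens_assoc_linear.
move: t; apply: eq_tens_linear => [||s w].
- exact: (linear_comp (la _ _ _) (lm _ _ _ _ _ _)).
- exact: (linear_comp (lm _ _ _ _ _ _) (la _ _ _)).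
rewrite !tens_mapE //; move: s; apply: eq_tens_linear => [a x y|a x y|u v].
- by rewrite lm tens_linl la.
- by rewrite tens_linl la lm.
by rewrite tens_mapE // !tens_assocE !tens_mapE.
Qed.

Lemma tens_mul_linl (K : choiceType)
    (m : {malg R[K]} -> {malg R[K]} -> {malg R[K]}) t :
  linear (fun s => tens_mul m s t).
Proof. by move=> ? ? ?; rewrite /tens_mul tens_lift_linear. Qed.

Lemma tens_mul_linr (K : choiceType)
    (m : {malg R[K]} -> {malg R[K]} -> {malg R[K]}) s :
  linear (tens_mul m s).
Proof.
by apply: tens_lift_param => u v ? ? ?; rewrite tens_lift_linear.
Qed.

Lemma tens_mulE (K : choiceType)
    (m : {malg R[K]} -> {malg R[K]} -> {malg R[K]}) a b c d : bilinear m ->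
  tens_mul m (tens a b) (tens c d) = tens (m a c) (m b d).
Proof.
case=> mr ml; have lb a' b' : bilinear (fun c d => tens (m a' c) (m b' d)).
  exact: bilinear_tens_map.
rewrite /tens_mul tens_liftE ?tens_liftE //.
split=> x; apply: tens_lift_param => u v e y z.
  by rewrite ml tens_linr.
by rewrite ml tens_linl.
Qed.

Lemma linear_tens_map (K L K' L' : choiceType) (V : lmodType R)
    (f : {malg R[K]} -> {malg R[K']}) (g : {malg R[L]} -> {malg R[L']})
    (h : tensor R K' L' -> V) t : linear h ->
  h (tens_map f g t) = tens_lift (fun u v => h (tens (f u) (g v))) t.
Proof. exact: linear_tens_lift. Qed.

(* Otherwise a failing unification of two tensors unfolds them and diverges.  *)
Local Opaque tens tens_lift tens_map tens_assoc tens_mul lin_ext mkmalgU.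

(** Both sides are bilinear in [s] and [t], so pure tensors suffice. This transports the
    compatibility of product and coproduct. *)
Lemma tens_mul_nat (K L : choiceType)
    (m : {malg R[K]} -> {malg R[K]} -> {malg R[K]})
    (n : {malg R[L]} -> {malg R[L]} -> {malg R[L]})
    (f : {malg R[K]} -> {malg R[L]}) s t :
  bilinear m -> bilinear n -> linear f ->
  {morph f : x y / m x y >-> n x y} ->
  tens_map f f (tens_mul m s t) = tens_mul n (tens_map f f s) (tens_map f f t).
Proof.
move=> bm bn lf fM; have lm := @tens_map_linear K K L L f f.
move: s; apply: eq_tens_linear => [||a b].
- exact: (linear_comp lm (tens_mul_linl _ _)).
- exact: (linear_comp (tens_mul_linl n _) lm).
move: t; apply: eq_tens_linear => [||c d].
- exact: (linear_comp lm (tens_mul_linr _ _)).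
- exact: (linear_comp (tens_mul_linr n _) lm).
have E := fun u v => tens_mapE (f := f) (g := f) u v lf lf.
rewrite (tens_mulE _ _ _ _ bm) [LHS]E [X in _ = tens_mul n X _]E.
by rewrite [X in _ = tens_mul n _ X]E (tens_mulE _ _ _ _ bn) !fM.
Qed.
End TensorCalculus.

(** * Uniqueness of the antipode and transport along a linear bijection *)

Section HopfTransport.
Context {R : fieldType}.

Local Opaque tens tens_lift tens_map tens_assoc tens_mul lin_ext mkmalgU.

(** Antipodes are convolution inverses of the identity, and a left inverse equals a right inverse in
    a monoid. *)
Lemma antipode_uniq (K : choiceType) (B : bialgebra_data (R := R) K)
    (S T : {malg R[K]} -> {malg R[K]}) :
  is_bialgebra B -> is_antipode B S -> is_antipode B T -> S =1 T.
Proof.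
case=> -[[mr ml] mA m1 m1r] [cl el cA c1 c1r] _ _ _ _ [lS Sl Sr] [lT Tl Tr] x.
(* Applied to the two sides of coassociativity, [F] gives the two bracketings of the convolution of
   [S], [id] and [T]. *)
pose F r : {malg R[K]} := tens_lift (fun u z =>
  tens_lift (fun v w => bmul B (S u) (bmul B v (T w))) z) r.
have lF : linear F by by move=> ? ? ?; rewrite /F tens_lift_linear.
have FE u v w : F (tens u (tens v w)) = bmul B (S u) (bmul B v (T w)).
  rewrite /F tens_liftE ?tens_liftE //.
  - by split=> [? ? ? ?|? ? ? ?]; rewrite ?lT ?ml ?mr.
  - split=> [?|?]; first by move=> ? ? ?; rewrite tens_lift_linear.
    by apply: tens_lift_param => ? ? ? ? ?; rewrite lS ml.
have lF' u : bilinear (fun v w => bmul B (S u) (bmul B v (T w))).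
  by split=> [? ? ? ?|? ? ? ?]; rewrite ?lT ?ml ?mr.
have lF2 : bilinear (fun u z =>
    tens_lift (fun v w => bmul B (S u) (bmul B v (T w))) z).
  split=> [?|?]; first by move=> ? ? ?; rewrite tens_lift_linear.
  by apply: tens_lift_param => ? ? ? ? ?; rewrite lS ml.
have := congr1 F (cA x).
rewrite {2}/F tens_lift_map //.
rewrite (linear_tens_map _ _ _ (@tens_assoc_linear _ _ _ _)).
rewrite (linear_tens_lift _ _ lF).
(* Here [S] meets [id] first: the integrand is ε(u) T(v), and the sum is [T x]. *)
under eq_tens_lift => u v.
  have -> : F (tens_assoc (tens (bcomul B u) v)) =
      bmul B (bcounit B u *: bunit B) (T v).
    rewrite -Sl (linear_tens_lift _ _ (ml (T v))).
    have lG : linear (fun r => F (tens_assoc (tens r v))).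
      by move=> ? ? ?; rewrite tens_linl tens_assoc_linear lF.
    rewrite -[LHS]/((fun r => F (tens_assoc (tens r v))) (bcomul B u)).
    move: (bcomul B u); apply: eq_malg_linear => //.
      by move=> ? ? ?; rewrite tens_lift_linear.
    move=> [k l]; rewrite -tensUU tens_assocE FE tens_liftE ?mA //.
    by split=> [? ? ? ?|? ? ? ?]; rewrite ?lS ?ml ?mr ?ml.
  rewrite (linear_scaleE _ _ (ml _)) m1 -(linear_scaleE _ _ lT).
  over.
(* Here [id] meets [T] first: the integrand is ε(v) S(u), and the sum is [S x]. *)
under [RHS]eq_tens_lift => u v.
  rewrite -(linear_tens_lift _ _ (mr (S u))) Tr (linear_scaleE _ _ (mr _)).
  rewrite m1r -(linear_scaleE _ _ lS).
  over.
by rewrite -!linear_tens_lift // c1 c1r.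
Qed.

Section Transport.
Context {K L : choiceType}.
Context (B : bialgebra_data (R := R) K) (C : bialgebra_data (R := R) L).
Context (f : {malg R[L]} -> {malg R[K]}) (g : {malg R[K]} -> {malg R[L]}).
Hypotheses (fK : cancel f g) (gK : cancel g f) (lf : linear f).
Hypothesis CmulE : forall x y, bmul C x y = g (bmul B (f x) (f y)).
Hypothesis CunitE : bunit C = g (bunit B).
Hypothesis CcomulE : forall x, bcomul C x = tens_map g g (bcomul B (f x)).
Hypothesis CcounitE : forall x, bcounit C x = bcounit B (f x).

Let lg : linear g. Proof. exact: linear_can fK gK. Qed.

Lemma transport_algebra : is_algebra B -> is_algebra C.
Proof.
case=> [[mr ml] mA m1 m1r]; split.
- by split=> [u a v w|v a u w]; rewrite !CmulE lf ?mr ?ml lg.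
- by move=> x y z; rewrite !CmulE !gK mA.
- by move=> x; rewrite CmulE CunitE gK m1 fK.
- by move=> x; rewrite CmulE CunitE gK m1r fK.
Qed.

Lemma transport_coalgebra : is_coalgebra B -> is_coalgebra C.
Proof.
case=> [cl el cA c1 c1r].
have lc : linear (bcomul C).
  by move=> a u v; rewrite !CcomulE lf cl tens_map_linear.
have CgE u : bcomul C (g u) = tens_map g g (bcomul B u) by rewrite CcomulE gK.
split=> // [a u v|x|x|x].
- by rewrite !CcounitE lf el.
- have lG : linear (tens_map g g) by exact: tens_map_linear.
  have lid := @linear_id R; rewrite (CcomulE x).
  rewrite (tens_map_comp _ _ _ lc (lid _)) (tens_map_comp _ _ _ (lid _) lc).
  (* Since [g] intertwines the coproducts, both sides become the image under g ⊗ (g ⊗ g) of the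
     corresponding side for [B], by naturality of [tens_assoc]. *)
  have EG : bcomul C \o g =1 tens_map g g \o bcomul B by move=> u; exact: CgE.
  rewrite (eq_tens_map (f' := tens_map g g \o bcomul B) (g' := g \o id)) //.
  rewrite [RHS](eq_tens_map (f' := g \o id)
    (g' := tens_map g g \o bcomul B)) //.
  rewrite -(tens_map_comp _ _ _ lG lg) -(tens_map_comp _ _ _ lg lG).
  by rewrite (tens_assoc_nat _ lg lg lg) cA.
- rewrite CcomulE tens_lift_map; last first.
    split=> [u a v w|v a u w]; first by rewrite scalerDr !scalerA mulrC.
    by rewrite !CcounitE lf el scalerDl scalerA.
  rewrite -[RHS]fK -[X in _ = g X]c1 (linear_tens_lift _ _ lg).
  by apply: eq_tens_lift => u v; rewrite CcounitE gK linear_scaleE.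
- rewrite CcomulE tens_lift_map; last first.
    split=> [v a u w|u a v w]; last by rewrite scalerDr !scalerA mulrC.
    by rewrite !CcounitE lf el scalerDl scalerA.
  rewrite -[RHS]fK -[X in _ = g X]c1r (linear_tens_lift _ _ lg).
  by apply: eq_tens_lift => u v; rewrite CcounitE gK linear_scaleE.
Qed.

Lemma transport_bialgebra : is_bialgebra B -> is_bialgebra C.
Proof.
case=> Balg Bcoalg cM c1 eM e1.
have Calg := transport_algebra Balg.
split=> // [|x y||x y|]; first exact: transport_coalgebra.
- rewrite !CcomulE CmulE gK cM; apply: tens_mul_nat => //.
  + exact: bmul_bilinear Balg.
  + exact: bmul_bilinear Calg.
  + by move=> u v; rewrite CmulE !gK.
- by rewrite CcomulE CunitE gK c1 tens_mapE.
- by rewrite !CcounitE CmulE gK eM.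
- by rewrite CcounitE CunitE gK.
Qed.

Lemma transport_antipode S :
  is_algebra B -> is_antipode B S -> is_antipode C (g \o S \o f).
Proof.
move=> Balg [lS Sl Sr]; have [[mr ml] _ _ _] := transport_algebra Balg.
have lT : linear (g \o S \o f) by move=> a u v /=; rewrite lf lS lg.
split=> // x; rewrite CcomulE tens_lift_map.
- rewrite CcounitE CunitE -linear_scaleE // -Sl (linear_tens_lift _ _ lg).
  by apply: eq_tens_lift => u v; rewrite CmulE /= !gK.
- by split=> [u|v a u w]; [exact: mr | rewrite lT ml].
- rewrite CcounitE CunitE -linear_scaleE // -Sr (linear_tens_lift _ _ lg).
  by apply: eq_tens_lift => u v; rewrite CmulE /= !gK.
- by split=> [u a v w|v]; [rewrite lT mr | exact: ml].
Qed.

Lemma transport_hopf_iso : is_hopf B -> is_hopf_iso B C g.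
Proof.
move=> hB; have [Bbi [S Sant]] := hB; have Cbi := transport_bialgebra Bbi.
have Tant S' := transport_antipode (S := S') (bialgebra_algebra Bbi).
split=> //.
- by split=> //; exists (g \o S \o f); exact: Tant.
- by exists f.
- by move=> x y; rewrite CmulE !gK.
- by move=> x; rewrite CcomulE gK.
- by move=> x; rewrite CcounitE gK.
(* The conjugate of [S'] by [g] is an antipode of [C], hence equals the given [T]. *)
move=> S' T S'ant T'ant x.
by rewrite -(antipode_uniq Cbi (Tant _ S'ant) T'ant) /= gK.
Qed.
End Transport.
End HopfTransport.

(** * Unital algebra morphisms *)

(* The algebra structure induced on [{malg R[M * N]}] is that of the tensor   *)
(* product, see [tensM].                                                      *)
Section ProductMonomial.
Context (M N : conomType).

Definition prod_mone : M * N := (mone, mone).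
Definition prod_mmul (p q : M * N) : M * N := (mmul p.1 q.1, mmul p.2 q.2).

Lemma prod_mmulA : associative prod_mmul.
Proof. by move=> p q r; rewrite /prod_mmul /= !mulmA. Qed.

Lemma prod_mul1m : left_id prod_mone prod_mmul.
Proof. by case=> m n; rewrite /prod_mmul /= !mul1m. Qed.

Lemma prod_mulm1 : right_id prod_mone prod_mmul.
Proof. by case=> m n; rewrite /prod_mmul /= !mulm1. Qed.

Lemma prod_unitm p q :
  prod_mmul p q = prod_mone -> p = prod_mone /\ q = prod_mone.
Proof. by case: p q => [m n] [m' n'] [] /unitm[-> ->] /unitm[-> ->]. Qed.

Lemma prod_mmulC : commutative prod_mmul.
Proof. by move=> p q; rewrite /prod_mmul mulmC (mulmC q.2). Qed.

HB.instance Definition _ := Choice_isMonomialDef.Build (M * N)%type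
  prod_mmulA prod_mul1m prod_mulm1 prod_unitm.
HB.instance Definition _ := MonomialDef_isConomialDef.Build (M * N)%type
  prod_mmulC.
End ProductMonomial.

Section AlgebraMorphism.
Context {R : fieldType}.

Record is_algmor (S T : algType R) (f : S -> T) : Prop := IsAlgmor {
  algmor_linear : linear f;
  algmorM : {morph f : x y / x * y};
  algmor1 : f 1 = 1 }.

Lemma algmor_comp (S T U : algType R) (f : T -> U) (g : S -> T) :
  is_algmor f -> is_algmor g -> is_algmor (f \o g).
Proof.
case=> lf fM f1 [lg gM g1]; split; first exact: linear_comp.
  by move=> x y /=; rewrite gM fM.
by rewrite /= g1 f1.
Qed.

Lemma algmor_id (S : algType R) : is_algmor (@id S).
Proof. by []. Qed.

Lemma malg_mulUU (M : monomType) (m n : M) :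
  << m >> * << n >> = << mmul m n >> :> {malg R[M]}.
Proof. by rewrite malgM_def fgmulUU mulr1. Qed.

Lemma algmor_basis (M : conomType) (T : algType R) (f : {malg R[M]} -> T) :
  linear f -> (forall m n, f << mmul m n >> = f << m >> * f << n >>) ->
  f 1 = 1 -> is_algmor f.
Proof.
move=> lf fM f1; split=> // x y.
move: x; apply: eq_malg_linear => [a x z|a x z|m].
- by rewrite mulrDl -scalerAl lf.
- by rewrite lf mulrDl -scalerAl.
move: y; apply: eq_malg_linear => [a x z|a x z|n].
- by rewrite mulrDr -scalerAr lf.
- by rewrite lf mulrDr -scalerAr.
by rewrite malg_mulUU fM.
Qed.


Lemma tens11 (M N : conomType) :
  tens (1 : {malg R[M]}) (1 : {malg R[N]}) = 1 :> {malg R[(M * N)%type]}.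
Proof. exact: tensUU. Qed.

Lemma tensM (M N : conomType) (u u' : {malg R[M]}) (v v' : {malg R[N]}) :
  tens u v * tens u' v' = tens (u * u') (v * v') :> {malg R[(M * N)%type]}.
Proof.
move: u; apply: eq_malg_linear => [a x y|a x y|m].
- by rewrite tens_linl mulrDl -scalerAl.
- by rewrite mulrDl -scalerAl tens_linl.
move: v; apply: eq_malg_linear => [a x y|a x y|n].
- by rewrite tens_linr mulrDl -scalerAl.
- by rewrite mulrDl -scalerAl tens_linr.
move: u'; apply: eq_malg_linear => [a x y|a x y|m'].
- by rewrite tens_linl mulrDr -scalerAr.
- by rewrite mulrDr -scalerAr tens_linl.
move: v'; apply: eq_malg_linear => [a x y|a x y|n'].
- by rewrite tens_linr mulrDr -scalerAr.
- by rewrite mulrDr -scalerAr tens_linr.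
by rewrite !tensUU !malg_mulUU tensUU.
Qed.

Lemma algmor_tens_lift (M N : conomType) (T : algType R)
    (b : {malg R[M]} -> {malg R[N]} -> T) : bilinear b ->
  (forall u v u' v', b (u * u') (v * v') = b u v * b u' v') -> b 1 1 = 1 ->
  is_algmor (tens_lift b).
Proof.
move=> bb bM b1; apply: algmor_basis => [|[m n] [m' n']|].
- by move=> ? ? ?; rewrite tens_lift_linear.
- by rewrite /tens_lift !lin_extU -!malg_mulUU bM.
- by rewrite -tens11 tens_liftE.
Qed.

Lemma algmor_tens_map (M N M' N' : conomType)
    (f : {malg R[M]} -> {malg R[M']}) (g : {malg R[N]} -> {malg R[N']}) :
  is_algmor f -> is_algmor g -> is_algmor (tens_map f g).
Proof.
case=> lf fM f1 [lg gM g1]; apply: algmor_tens_lift => [|u v u' v'|].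
- exact: bilinear_tens_map.
- by rewrite fM gM tensM.
- by rewrite f1 g1 tens11.
Qed.

Lemma tens_assocU (K L N : choiceType) (k : K) (l : L) (n : N) :
  tens_assoc << ((k, l), n) >> =
  << (k, (l, n)) >> :> {malg R[(K * (L * N)%type)%type]}.
Proof. by rewrite -!tensUU tens_assocE. Qed.

Lemma algmor_tens_assoc (M N P : conomType) :
  is_algmor (@tens_assoc R M N P).
Proof.
apply: algmor_basis => [|[[m n] p] [[m' n'] p']|].
- exact: tens_assoc_linear.
- rewrite [LHS](tens_assocU (mmul m m') (mmul n n') (mmul p p')).
  by rewrite [X in _ = X * _]tens_assocU [X in _ = _ * X]tens_assocU malg_mulUU.
- exact: (tens_assocU mone mone mone).
Qed.

(** This turns the bialgebra axiom on products into multiplicativity of [comul] for the ring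
    structure of [H ⊗ H]. *)
Lemma tens_mul_ring (M : conomType) (s t : {malg R[(M * M)%type]}) :
  tens_mul *%R s t = s * t.
Proof.
have bm : bilinear ( *%R : {malg R[M]} -> {malg R[M]} -> {malg R[M]}).
  split=> [u a x y|u a x y]; first by rewrite mulrDr -scalerAr.
  by rewrite mulrDl -scalerAl.
move: s; apply: eq_tens_linear => [|a x y|a b].
- exact: tens_mul_linl.
- by rewrite mulrDl scalerAl.
move: t; apply: eq_tens_linear => [|a' x y|c d].
- exact: tens_mul_linr.
- by rewrite mulrDr scalerAr.
by rewrite tens_mulE // tensM.
Qed.

(** A monomial other than [mone] has a letter in its support, and removing that letter lowers the
    degree by one. *)
Lemma cmonom_ind (A : choiceType) (P : {cmonom A} -> Prop) :
  P mone -> (forall m a, P m -> P (mmul m (ucm a))) -> forall m, P m.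
Proof.
move=> P1 PM m; have [n] := ubnP (mdeg m); elim: n m => // n IHn m.
have [->//|m_neq1] := eqVneq m mone.
have /fset0Pn[a a_m] : finsupp (cmonom_val m) != fset0.
  by apply: contraNneq m_neq1 => m0; rewrite -mdeg_eq0 mdegE m0 big_seq_fset0.
have mE : m = mmul (divcm m (ucm a)) (ucm a).
  apply/eqP/cmP => b; rewrite cmM divcmE cmU subnK //.
  by case: eqVneq => // <-; rewrite lt0n cmE_neq0.
by rewrite mE mdegM mdegU addn1 ltnS => /IHn; exact: PM.
Qed.

Lemma eq_algmor (A : choiceType) (T : algType R)
    (f g : {malg R[{cmonom A}]} -> T) : is_algmor f -> is_algmor g ->
  (forall a, f << ucm a >> = g << ucm a >>) -> f =1 g.
Proof.
case=> lf fM f1 [lg gM g1] fg; apply: eq_malg_linear => //.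
apply: cmonom_ind => [|m a IHm]; first exact: etrans f1 (esym g1).
rewrite -(malg_mulUU m (ucm a)).
by rewrite [LHS]fM [RHS]gM; congr (_ * _); [exact: IHm | exact: fg].
Qed.
End AlgebraMorphism.

(** * The coproduct on monomials *)

Section Coproduct.
Context (R : realType) (A : choiceType).
Notation M := {cmonom A}.
Notation H := {malg R[M]}.
Implicit Types (m n : M) (p q : M * M) (a : A) (x y : H).

Lemma cm_mulI m : injective (mmul m).
Proof.
move=> n n' /eqP/cmP e; apply/eqP/cmP => a.
by have := e a; rewrite !cmM => /addnI.
Qed.

Lemma cm_mulIr m : injective (mmul^~ m).
Proof. by move=> n n'; rewrite /= !(mulmC _ m) => /cm_mulI. Qed.

Lemma divcmK m a : (0 < m a)%N -> mmul (divcm m (ucm a)) (ucm a) = m.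
Proof.
move=> m_gt0; apply/eqP/cmP => b; rewrite cmM divcmE cmU subnK //.
by case: eqVneq => // <-.
Qed.

(** A factorization of [m a] comes from one of [m] by putting [a] in the left or the right factor.
    Finiteness is what keeps the sum in [comul_monom] from taking its default value. *)
Lemma finite_divisors m : finite_set [set p | mmul p.1 p.2 = m].
Proof.
move: m; apply: cmonom_ind => [|m a IHm].
  apply: (sub_finite_set _ (finite_set1 (mone, mone))).
  by move=> -[p q] /= /unitm[-> ->].
pose f p := (mmul p.1 (ucm a), p.2); pose g p := (p.1, mmul p.2 (ucm a)).
apply: (@sub_finite_set _ _ ((f @` [set p | mmul p.1 p.2 = m])
    `|` (g @` [set p | mmul p.1 p.2 = m]))); last first.
  by rewrite finite_setU; split; exact: finite_image.
move=> [p q] /= pq; have : (0 < mmul p q a)%N by rewrite pq cmM cmUU addn1.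
rewrite cmM addn_gt0 => /orP[] /divcmK rE; move: pq; rewrite -rE => pq.
  left; exists (divcm p (ucm a), q) => //=.
  by apply: (@cm_mulIr (ucm a)); rewrite /= -mulmA (mulmC q) mulmA.
right; exists (p, divcm q (ucm a)) => //=.
by apply: (@cm_mulIr (ucm a)); rewrite /= -mulmA.
Qed.

Lemma mcoeff_comul_monom m p : (comul_monom R m)@_p =
  if mmul p.1 p.2 == m then coeff_monom R m p.1 p.2 else 0.
Proof.
rewrite /comul_monom (fsbig_finite _ _ (finite_divisors m)).
rewrite raddf_sum /=.
transitivity (\sum_(k <- fset_set [set p | mmul p.1 p.2 = m])
    (coeff_monom R m k.1 k.2 * (k == p)%:R)).
  by apply: eq_bigr => -[k l] _; rewrite mcoeffZ tensUU mcoeffU1.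
have memE : (p \in fset_set [set p | mmul p.1 p.2 = m]) = (mmul p.1 p.2 == m).
  by rewrite in_fset_set; [apply/idP/eqP; rewrite inE | exact: finite_divisors].
case: ifPn => p_m.
  rewrite (big_fsetD1 p) ?memE //= eqxx mulr1 big1_fset ?addr0 // => k.
  by rewrite in_fsetD1 => /andP[/negPf-> _] _; rewrite mulr0.
rewrite big1_fset // => k k_m _; case: eqVneq k_m => [->|_ _].
  by rewrite memE (negPf p_m).
by rewrite mulr0.
Qed.

(** Off [d] both exponents vanish and the factor is 0!/(0! 0!) = 1. *)
Lemma coeff_monomE (d : {fset A}) m1 m2 : {subset finsupp (mmul m1 m2) <= d} ->
  coeff_monom R (mmul m1 m2) m1 m2 =
  \prod_(a <- d) ((m1 a + m2 a)`!%:R / ((m1 a)`!%:R * (m2 a)`!%:R)).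
Proof.
move=> le_d; rewrite /coeff_monom (@fsbigTE _ _ _ _ d) => [|a a_d].
  by apply: eq_bigr => a _; rewrite cmM.
have : a \notin finsupp (mmul m1 m2) by apply: contra a_d; exact: le_d.
rewrite -cmE_eq0 cmM addn_eq0 => /andP[/eqP-> /eqP->].
by rewrite mulr1 divr1.
Qed.

(** Pascal's rule for binomials written as factorial quotients. The tests suppress the terms with a
    truncated predecessor; at i = j = 0 the rule would read 1 = 0. *)
Lemma multinomial_pascal i j : (0 < i + j)%N ->
  (i + j)`!%:R / (i`!%:R * j`!%:R) =
  (if (0 < i)%N then (i.-1 + j)`!%:R / (i.-1`!%:R * j`!%:R) else 0)
  + (if (0 < j)%N then (i + j.-1)`!%:R / (i`!%:R * j.-1`!%:R) else 0) :> R.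
Proof.
have f0 k : k`!%:R != 0 :> R by rewrite pnatr_eq0 -lt0n fact_gt0.
case: i j => [|i] [|j] //= _; rewrite ?addn0 ?add0n ?add0r ?addr0.
- by rewrite fact0 !mul1r !divff.
- by rewrite fact0 !mulr1 !divff.
rewrite (addSnnS i j) (_ : (i.+1 + j.+1)%N = (i + j.+1).+1) //.
rewrite factS (factS i) (factS j) !natrM -[in LHS]addSn natrD.
have i0 : i.+1%:R != 0 :> R by rewrite pnatr_eq0.
have j0 : j.+1%:R != 0 :> R by rewrite pnatr_eq0.
by field; rewrite !f0 !nat1r i0 j0.
Qed.

Lemma coeff_monom_pascal m a m1 m2 : mmul m1 m2 = mmul m (ucm a) ->
  coeff_monom R (mmul m (ucm a)) m1 m2 =
  (if (0 < m1 a)%N then coeff_monom R m (divcm m1 (ucm a)) m2 else 0)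
  + (if (0 < m2 a)%N then coeff_monom R m m1 (divcm m2 (ucm a)) else 0).
Proof.
move=> m12; pose d := finsupp (mmul m (ucm a)).
have a_d : a \in d by rewrite -cmE_neq0 cmM cmUU addn1.
pose c n1 n2 (b : A) : R := (n1 b + n2 b)`!%:R / ((n1 b)`!%:R * (n2 b)`!%:R).
(* The three coefficients differ only in their factor at [a]; the product over the other letters is
   common, which leaves the scalar rule. *)
have cE n1 n2 : {subset finsupp (mmul n1 n2) <= d} ->
    (forall b, b != a -> n1 b = m1 b /\ n2 b = m2 b) ->
    coeff_monom R (mmul n1 n2) n1 n2 =
    c n1 n2 a * \prod_(b <- (d `\ a)%fset) c m1 m2 b.
  move=> le_d n12; rewrite (coeff_monomE le_d) (big_fsetD1 a) //=.
  congr (_ * _).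
  by apply: eq_fbigr => b; rewrite in_fsetD1 => /andP[/n12[-> ->]].
have le_d : {subset finsupp m <= d} by move=> b; rewrite /d mdomD inE => ->.
have divE n b : b != a -> divcm n (ucm a) b = n b.
  by move=> ba; rewrite divcmE cmU eq_sym (negPf ba) subn0.
have m12a : (0 < m1 a + m2 a)%N by rewrite -cmM m12 cmM cmUU addn1.
rewrite -m12 cE // ?m12 // /c (multinomial_pascal m12a) mulrDl; congr (_ + _).
  case: ifPn => [m1a|_]; last by rewrite mul0r.
  have E : mmul (divcm m1 (ucm a)) m2 = m.
    apply: (@cm_mulIr (ucm a)).
    by rewrite /= -mulmA (mulmC m2) mulmA divcmK.
  rewrite -[in RHS]E cE ?E // => [|b ba]; last by rewrite divE.
  by rewrite /c divcmE cmUU subn1.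
case: ifPn => [m2a|_]; last by rewrite mul0r.
have E : mmul m1 (divcm m2 (ucm a)) = m.
  by apply: (@cm_mulIr (ucm a)); rewrite /= -mulmA divcmK.
rewrite -[in RHS]E cE ?E // => [|b ba]; last by rewrite divE.
by rewrite /c divcmE cmUU subn1.
Qed.

End Coproduct.

(** * The Hopf algebra [H] *)

Section MulBasis.
Context (R : fieldType) (K : conomType) (k : K).

Lemma mcoeff_mulU_linear p :
  linear (fun t : {malg R[K]} => (t * << k >>)@_p : R^o).
Proof. by move=> a x y; rewrite mulrDl -scalerAl mcoeffD mcoeffZ. Qed.

Lemma mcoeff_mulU (t : {malg R[K]}) p : injective (mmul^~ k) ->
  (t * << k >>)@_(mmul p k) = t@_p.
Proof.
move=> inj_k; move: t; apply: (@eq_malg_linear _ _ R^o) => [|a x y|l].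
- exact: mcoeff_mulU_linear.
- by rewrite mcoeffD mcoeffZ.
by rewrite malg_mulUU !mcoeffU1 (inj_eq inj_k).
Qed.

Lemma mcoeff_mulU_eq0 (t : {malg R[K]}) p : (forall l, mmul l k != p) ->
  (t * << k >>)@_p = 0.
Proof.
move=> k_p; move: t; apply: (@eq_malg_linear _ _ R^o) => [|a x y|l].
- exact: mcoeff_mulU_linear.
- by rewrite scaler0 addr0.
by rewrite malg_mulUU mcoeffU1 (negPf (k_p l)).
Qed.
End MulBasis.

(** Multiplicativity in the second monomial follows by induction, adding one letter at a time. *)
Lemma algmor_lin_ext (R : fieldType) (A : choiceType) (T : algType R)
    (f : {cmonom A} -> T) (g : A -> T) :
  f mone = 1 -> (forall m a, f (mmul m (ucm a)) = f m * g a) ->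
  is_algmor (lin_ext f : {malg R[{cmonom A}]} -> T).
Proof.
move=> f1 fM; apply: algmor_basis => [|m n|]; first exact: lin_ext_linear.
  rewrite [LHS]lin_extU [X in _ = X * _]lin_extU [X in _ = _ * X]lin_extU.
  move: n; apply: cmonom_ind => [|n a IHn].
    by rewrite mulm1 f1 mulr1.
  by rewrite mulmA !fM IHn mulrA.
exact: etrans (lin_extU f mone) f1.
Qed.

Section HopfMonomials.
Context (R : realType) (A : choiceType).
Notation M := {cmonom A}.
Notation H := {malg R[M]}.
Notation HH := {malg R[(M * M)%type]}.
Implicit Types (m n : M) (p q : M * M) (a : A) (x y : H).

Definition primitive a : HH := << (ucm a, mone) >> + << (mone, ucm a) >>.

(** Multiplying by a basis element shifts coefficients, because monomials are cancellative. The two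
    summands have the shape of the two terms of [coeff_monom_pascal]. *)
Lemma mcoeff_mul_primitive (t : HH) p a : (t * primitive a)@_p =
  (if (0 < p.1 a)%N then t@_(divcm p.1 (ucm a), p.2) else 0)
  + (if (0 < p.2 a)%N then t@_(p.1, divcm p.2 (ucm a)) else 0).
Proof.
rewrite mulrDr mcoeffD; congr (_ + _); case: ifPn => [p_a|].
- rewrite -[in LHS](_ : mmul (divcm p.1 (ucm a), p.2) (ucm a, mone) = p).
    rewrite mcoeff_mulU // => -[q1 q2] [r1 r2] [] /cm_mulIr-> /cm_mulIr-> //.
  by case: p p_a => p1 p2 /= p_a; congr (_, _); rewrite /= ?divcmK ?mulm1.
- rewrite -eqn0Ngt => /eqP p_a; apply: mcoeff_mulU_eq0 => l.
  apply/eqP => /(congr1 (fun q => q.1 a)) /=.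
  by rewrite p_a cmM cmUU addn1.
- rewrite -[in LHS](_ : mmul (p.1, divcm p.2 (ucm a)) (mone, ucm a) = p).
    rewrite mcoeff_mulU // => -[q1 q2] [r1 r2] [] /cm_mulIr-> /cm_mulIr-> //.
  by case: p p_a => p1 p2 /= p_a; congr (_, _); rewrite /= ?divcmK ?mulm1.
- rewrite -eqn0Ngt => /eqP p_a; apply: mcoeff_mulU_eq0 => l.
  apply/eqP => /(congr1 (fun q => q.2 a)) /=.
  by rewrite p_a cmM cmUU addn1.
Qed.

Lemma comul_monomM m a :
  comul_monom R (mmul m (ucm a)) = comul_monom R m * primitive a :> HH.
Proof.
move: (comul_monom R _) (comul_monom R m)
  (@mcoeff_comul_monom R A (mmul m (ucm a))) (@mcoeff_comul_monom R A m)
  => t' t t'E tE.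
apply/malgP => p; rewrite mcoeff_mul_primitive t'E !tE /=.
have divl : (0 < p.1 a)%N -> (mmul (divcm p.1 (ucm a)) p.2 == m) =
    (mmul p.1 p.2 == mmul m (ucm a)).
  move=> p_a; rewrite -(inj_eq (@cm_mulIr _ (ucm a))) /=.
  by rewrite -mulmA (mulmC p.2) mulmA divcmK.
have divr : (0 < p.2 a)%N -> (mmul p.1 (divcm p.2 (ucm a)) == m) =
    (mmul p.1 p.2 == mmul m (ucm a)).
  move=> p_a; rewrite -(inj_eq (@cm_mulIr _ (ucm a))) /=.
  by rewrite -mulmA divcmK.
have [pm|pm] := eqVneq.
  rewrite coeff_monom_pascal //; congr (_ + _).
    by case: ifPn => // p_a; rewrite divl // pm eqxx.
  by case: ifPn => // p_a; rewrite divr // pm eqxx.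
case: ifPn => [p_a|_]; rewrite ?divl ?(negPf pm) //.
  by case: ifPn => [p_b|_]; rewrite ?divr ?(negPf pm) ?addr0.
by case: ifPn => [p_b|_]; rewrite ?divr ?(negPf pm) ?addr0.
Qed.

Lemma comul_monom1 : comul_monom R (mone : M) = 1 :> HH.
Proof.
move: (comul_monom R _) (@mcoeff_comul_monom R A (mone : M)) => t tE.
apply/malgP => -[p q]; rewrite tE /= mcoeff1 -[X in X == _]/(mmul _ _).
have -> : ((p, q) == mone :> M * M) = (mmul p q == mone).
  by apply/eqP/eqP => [[-> ->]|/unitm[-> ->]] //; rewrite mulm1.
case: eqVneq => // /unitm[-> ->].
have := @coeff_monomE R A fset0 mone mone; rewrite !mulm1 => ->.
  by rewrite big_seq_fset0.
by move=> a; rewrite mdom1.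
Qed.

Lemma algmor_comul : is_algmor (@comul R A : H -> HH).
Proof.
exact: (algmor_lin_ext (g := primitive) comul_monom1 comul_monomM).
Qed.

Lemma comul_ucm a : comul << ucm a >> =
  tens << ucm a >> (1 : H) + tens (1 : H) << ucm a >> :> HH.
Proof.
have := comul_monomM mone a; rewrite comul_monom1 mul1m mul1r => E.
rewrite /comul lin_extU E /primitive.
by congr (_ + _); exact/esym/tensUU.
Qed.

Lemma tens_lift_comul_ucm (V : lmodType R) (b : H -> H -> V) a : bilinear b ->
  tens_lift b (comul << ucm a >>) = b << ucm a >> 1 + b 1 << ucm a >>.
Proof.
move=> bb; rewrite comul_ucm (linear_addE _ _ (tens_lift_linear b)).
by congr (_ + _); exact: tens_liftE.
Qed.

Lemma algmor_counit : is_algmor (@counit R A : H -> R^o).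
Proof.
apply: (@algmor_lin_ext _ _ R^o _ (fun=> 0)) => [|m a]; first by rewrite eqxx.
by rewrite mulr0 cmM_eq1 cm1_eq1 andbF.
Qed.

Lemma counit_ucm a : counit (<< ucm a >> : H) = 0.
Proof. by rewrite /counit lin_extU cm1_eq1. Qed.

(** The algebra morphism sending each generator to its opposite. *)
Definition antipodeH : H -> H := lin_ext (fun m => (-1) ^+ mdeg m *: << m >>).

Lemma algmor_antipodeH : is_algmor antipodeH.
Proof.
apply: (@algmor_lin_ext _ _ _ _ (fun a => - << ucm a >>)) => [|m a].
  by rewrite mdeg1 expr0 scale1r.
rewrite mdegM mdegU addn1 exprSr mulrN1 scaleNr mulrN -scalerAl.
by congr (- (_ *: _)); exact/esym/malg_mulUU.
Qed.

Lemma antipodeH_ucm a : antipodeH << ucm a >> = - << ucm a >>.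
Proof. by rewrite /antipodeH lin_extU mdegU expr1 scaleN1r. Qed.

Lemma coassoc_comul x :
  tens_assoc (tens_map (@comul R A) id (comul x)) =
  tens_map id (@comul R A) (comul x).
Proof.
have cM := algmor_comul; have idM := algmor_id H.
have lc := algmor_linear cM; have lid := algmor_linear idM.
move: x; apply: (@eq_algmor _ _ {malg R[(M * (M * M)%type)%type]}) => [||a].
- exact: (algmor_comp (algmor_tens_assoc _ _ _)
    (algmor_comp (algmor_tens_map cM idM) cM)).
- exact: (algmor_comp (algmor_tens_map idM cM) cM).
(* On a generator u both sides are u ⊗ 1 ⊗ 1 + 1 ⊗ u ⊗ 1 + 1 ⊗ 1 ⊗ u. *)
set u : H := << ucm a >>.
have cu : comul u = tens u 1 + tens 1 u by exact: comul_ucm.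
have c1 : comul (1 : H) = tens 1 1 by rewrite (algmor1 cM) tens11.
move: lc cu c1; clearbody u; move: (@comul R A) => D lc cu c1.
have lm f g := @tens_map_linear R M M _ _ f g.
have El v w := tens_mapE v w lc lid; have Er v w := tens_mapE v w lid lc.
rewrite cu [in LHS](linear_addE _ _ (lm _ _ _ _)).
rewrite [RHS](linear_addE _ _ (lm _ _ _ _)).
rewrite [X in tens_assoc (X + _)]El [X in tens_assoc (_ + X)]El.
rewrite [X in _ = X + _]Er [X in _ = _ + X]Er cu c1.
have tDl (v v' : HH) (w : H) : tens (v + v') w = tens v w + tens v' w.
  exact: linear_addE (tens_linl w).
rewrite tDl.
have tDr (v : H) (w w' : HH) : tens v (w + w') = tens v w + tens v w'.
  exact: linear_addE (tens_linr v).
rewrite tDr.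
have la := @tens_assoc_linear R M M M.
rewrite !(linear_addE _ _ la) [X in X + _ + _]tens_assocE.
rewrite [X in _ + X + _ = _]tens_assocE [X in _ + X = _]tens_assocE.
by rewrite addrA.
Qed.
End HopfMonomials.

Section HopfH.
Context (R : realType) (A : choiceType).
Notation M := {cmonom A}.
Notation H := {malg R[M]}.
Notation HH := {malg R[(M * M)%type]}.
Implicit Types (m n : M) (a : A) (x y : H).

Lemma linear_bilinear_scale (l : H -> R) : scalar l ->
  bilinear (fun u v : H => l u *: v).
Proof.
move=> ll; split=> [u a v w|v a u w].
  by rewrite scalerDr !scalerA mulrC.
by rewrite ll scalerDl scalerA.
Qed.

Lemma bilinear_flip (U V W : lmodType R) (b : U -> V -> W) :
  bilinear b -> bilinear (fun v u => b u v).
Proof. by case. Qed.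

Lemma counit_scalar : scalar (@counit R A).
Proof. exact: algmor_linear (algmor_counit R A). Qed.

Lemma counit1 : counit (1 : H) = 1.
Proof. exact: algmor1 (algmor_counit R A). Qed.

Lemma counitM x y : counit (x * y) = counit x * counit y.
Proof. exact: algmorM (algmor_counit R A) x y. Qed.

Lemma counitl_comul x :
  tens_lift (fun u v => counit u *: v) (comul x) = x.
Proof.
have bb := linear_bilinear_scale counit_scalar.
move: x; apply: (@eq_algmor _ _ H) => [||a].
- apply: (algmor_comp _ (algmor_comul R A)).
  apply: algmor_tens_lift => [|u v u' v'|].
  + exact: bb.
  + by rewrite counitM -scalerAl -scalerAr scalerA.
  + by rewrite counit1 scale1r.
- exact: algmor_id.
rewrite (tens_lift_comul_ucm _ bb).
move: (<< ucm a >> : H) (@counit_ucm R A a) => u cu.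
by rewrite cu counit1 scale0r add0r scale1r.
Qed.

Lemma counitr_comul x :
  tens_lift (fun u v => counit v *: u) (comul x) = x.
Proof.
have bb := bilinear_flip (linear_bilinear_scale counit_scalar).
move: x; apply: (@eq_algmor _ _ H) => [||a].
- apply: (algmor_comp _ (algmor_comul R A)).
  apply: algmor_tens_lift => [|u v u' v'|].
  + exact: bb.
  + by rewrite counitM -scalerAl -scalerAr scalerA.
  + by rewrite counit1 scale1r.
- exact: algmor_id.
rewrite (tens_lift_comul_ucm _ bb).
move: (<< ucm a >> : H) (@counit_ucm R A a) => u cu.
by rewrite cu counit1 scale0r addr0 scale1r.
Qed.

Lemma mul_bilinear : bilinear ( *%R : H -> H -> H).
Proof.
split=> [u a x y|u a x y]; first by rewrite mulrDr -scalerAr.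
by rewrite mulrDl -scalerAl.
Qed.

Lemma algmor_unit_counit : is_algmor (fun x : H => counit x *: (1 : H)).
Proof.
split=> [a x y|x y|]; last by rewrite counit1 scale1r.
  by rewrite counit_scalar scalerDl scalerA.
by rewrite counitM -scalerAl mul1r scalerA.
Qed.

(** The left side is an algebra morphism because [H] is commutative ([mulrACA]); on a generator it
    is -a + a = 0. *)
Lemma antipodelH x :
  tens_lift (fun u v => antipodeH u * v) (comul x) = counit x *: (1 : H).
Proof.
have [lS SM S1] := algmor_antipodeH R A; have [mr ml] := mul_bilinear.
have bb : bilinear (fun u v : H => antipodeH u * v).
  by split=> [u|v a u w]; [exact: mr | rewrite lS ml].
move: x; apply: (@eq_algmor _ _ H) => [||a].
- apply: (algmor_comp _ (algmor_comul R A)).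
  apply: algmor_tens_lift => [|u v u' v'|].
  + exact: bb.
  + by rewrite SM [LHS]mulrACA.
  + by rewrite [LHS]mulr1; exact: S1.
- exact: algmor_unit_counit.
rewrite (tens_lift_comul_ucm _ bb).
move: (<< ucm a >> : H) (@counit_ucm R A a) (@antipodeH_ucm R A a) => u cu Su.
by rewrite cu Su S1 scale0r mulr1 mul1r addNr.
Qed.

Lemma antipoderH x :
  tens_lift (fun u v => u * antipodeH v) (comul x) = counit x *: (1 : H).
Proof.
have [lS SM S1] := algmor_antipodeH R A; have [mr ml] := mul_bilinear.
have bb : bilinear (fun u v : H => u * antipodeH v).
  by split=> [v a u w|v]; [rewrite lS mr | exact: ml].
move: x; apply: (@eq_algmor _ _ H) => [||a].
- apply: (algmor_comp _ (algmor_comul R A)).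
  apply: algmor_tens_lift => [|u v u' v'|].
  + exact: bb.
  + by rewrite SM [LHS]mulrACA.
  + by rewrite [LHS]mul1r; exact: S1.
- exact: algmor_unit_counit.
rewrite (tens_lift_comul_ucm _ bb).
move: (<< ucm a >> : H) (@counit_ucm R A a) (@antipodeH_ucm R A a) => u cu Su.
by rewrite cu Su S1 scale0r mulr1 mul1r addrN.
Qed.

Lemma hopfH_is_hopf : is_hopf (hopfH R A).
Proof.
have [lc cM c1] := algmor_comul R A; split; last first.
  exists (@antipodeH R A); split.
  - exact: algmor_linear (algmor_antipodeH R A).
  - exact: antipodelH.
  - exact: antipoderH.
split.
- split; [exact: mul_bilinear|exact: mulrA|exact: mul1r|exact: mulr1].
- split; [exact: lc|exact: counit_scalar|exact: coassoc_comul
    |exact: counitl_comul|exact: counitr_comul].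
- by move=> x y; rewrite [RHS]tens_mul_ring; exact: cM.
- exact: etrans c1 (esym (tens11 _ _)).
- exact: counitM.
- exact: counit1.
Qed.
End HopfH.

(** * Bijectivity of [phi] *)

Section DegreeFiltration.
Context (R : fieldType) (A : choiceType).
Notation H := {malg R[{cmonom A}]}.
Implicit Types (m k : {cmonom A}) (x y : H) (n : nat).

(** The bound is strict so that level 0 contains only the zero vector, where the inductions end. *)
Definition deg_lt n x := forall k, (n <= mdeg k)%N -> x@_k = 0.

Lemma deg_ltD n x y : deg_lt n x -> deg_lt n y -> deg_lt n (x + y).
Proof. by move=> Dx Dy k k_n; rewrite mcoeffD Dx // Dy // addr0. Qed.

Lemma deg_ltN n x : deg_lt n x -> deg_lt n (- x).
Proof. by move=> Dx k k_n; rewrite mcoeffN Dx // oppr0. Qed.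

Lemma deg_ltZ n c x : deg_lt n x -> deg_lt n (c *: x).
Proof. by move=> Dx k k_n; rewrite mcoeffZ Dx // mulr0. Qed.

Lemma deg_ltW n n' x : (n <= n')%N -> deg_lt n x -> deg_lt n' x.
Proof. by move=> le_n Dx k /(leq_trans le_n); exact: Dx. Qed.

Lemma deg_ltU m : deg_lt (mdeg m).+1 << m >>.
Proof.
move=> k; rewrite mcoeffU1; case: eqVneq => // ->.
by rewrite ltnn.
Qed.

Lemma deg_lt_mulU n x a : deg_lt n x -> deg_lt n.+1 (x * << ucm a >>).
Proof.
move=> Dx k k_n; have [k_a|] := posnP (k a).
  apply: mcoeff_mulU_eq0 => l; apply/eqP => /(congr1 (fun k => k a)).
  by rewrite k_a cmM cmUU addn1.
move=> /divcmK kE; rewrite -kE mcoeff_mulU; last exact: cm_mulIr.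
by apply: Dx; move: k_n; rewrite -[in X in X -> _]kE mdegM mdegU addn1.
Qed.

Lemma deg_lt_msize x : deg_lt (msize x) x.
Proof. by move=> k k_x; apply/mcoeff_outdom/msize_mdeg_ge. Qed.

Lemma deg_lt0 x : deg_lt 0 x -> x = 0.
Proof. by move=> Dx; apply/malgP => k; rewrite mcoeff0 Dx. Qed.

Lemma deg_lt_linear (f : H -> H) n x : linear f ->
  (forall m, deg_lt (mdeg m) (f << m >>)) -> deg_lt n.+1 x -> deg_lt n (f x).
Proof.
move=> lf Df Dx k k_n; rewrite (lin_ext_uniq lf (fun=> erefl)) /lin_ext.
rewrite raddf_sum big1_seq //= => m m_x; rewrite mcoeffZ Df ?mulr0 //.
apply: leq_trans k_n; rewrite leqNgt; apply: contraTN m_x => n_m.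
by rewrite -mcoeff_eq0 Dx.
Qed.

(** The map f - id strictly lowers degree, hence is locally nilpotent, and every vector has some
    finite degree. *)
Lemma unipotent_bijective (f : H -> H) : linear f ->
  (forall m, deg_lt (mdeg m) (f << m >> - << m >>)) ->
  injective f /\ (forall y, exists x, f x = y).
Proof.
move=> lf Df; pose h x := f x - x.
have lh : linear h.
  by move=> a x y; rewrite /h lf scalerBr opprD addrACA.
have Dh n x : deg_lt n.+1 x -> deg_lt n (f x - x).
  exact: (deg_lt_linear (f := h)).
have fB x y : f (x - y) = f x - f y.
  by rewrite addrC -scaleN1r lf scaleN1r addrC.
have f0 : f 0 = 0 by have := fB 0 0; rewrite !subrr.
have ker n z : deg_lt n z -> f z = 0 -> z = 0.
  elim: n => [|n IHn] Dz fz; first exact: (deg_lt0 Dz).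
  apply: IHn => //; rewrite -[z]opprK; apply: deg_ltN.
  by have := Dh _ _ Dz; rewrite fz sub0r.
split=> [x y fxy|y].
  apply: subr0_eq; apply: (ker (msize (x - y))); last by rewrite fB fxy subrr.
  exact: deg_lt_msize.
have : deg_lt (msize y) y by exact: deg_lt_msize.
move: (msize y) => n.
elim: n y => [|n IHn] y Dy; first by exists 0; rewrite (deg_lt0 Dy).
(* The induction gives z with f z = f y - y, so f (y - z) = y. *)
have [z fz] := IHn _ (Dh _ _ Dy).
by exists (y - z); rewrite fB fz opprB addrC subrK.
Qed.
End DegreeFiltration.

Section Phi.
Context (R : realType) (A : choiceType).
Notation M := {cmonom A}.
Notation H := {malg R[M]}.
Notation HH := {malg R[(M * M)%type]}.
Implicit Types (m k : M) (a : A) (x y : H) (n : nat) (l : H -> R).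

(** This is [phi] for an arbitrary form: the recursion replaces [lam] by forms that need not take
    the value 1 at the unit. *)
Definition contract l x : H := tens_lift (fun u v => l u *: v) (comul x).

Lemma contract_linear l : linear (contract l).
Proof.
move=> a x y; rewrite /contract (algmor_linear (algmor_comul R A)).
exact: tens_lift_linear.
Qed.

Lemma contract1 l : scalar l -> contract l 1 = l 1 *: 1.
Proof.
move=> ll; rewrite /contract (algmor1 (algmor_comul R A)) -tens11.
by rewrite tens_liftE //; exact: linear_bilinear_scale.
Qed.

Lemma contract_tensM l (t : HH) (w w' : H) : scalar l ->
  tens_lift (fun u v => l u *: v) (t * tens w w') =
  tens_lift (fun u v => l (u * w) *: (v * w')) t.
Proof.
move=> ll; have [_ ml] := mul_bilinear R A.
have bl := linear_bilinear_scale ll.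
have bb : bilinear (fun u v : H => l (u * w) *: (v * w')).
  split=> [u b v v'|v b u u'].
    by rewrite mulrDl -scalerAl scalerDr !scalerA mulrC.
  by rewrite mulrDl -scalerAl ll scalerDl scalerA.
move: t; apply: eq_tens_linear => [b s s'|b s s'|u v].
- by rewrite mulrDl -scalerAl tens_lift_linear.
- by rewrite tens_lift_linear.
rewrite [RHS](tens_liftE _ _ bb) tensM.
exact: (tens_liftE _ _ bl).
Qed.

Lemma scalar_mulr l (w : H) : scalar l -> scalar (fun u => l (u * w)).
Proof. by move=> ll b u v; rewrite mulrDl -scalerAl ll. Qed.

(** In Δ(x)(a ⊗ 1 + 1 ⊗ a), the factor 1 ⊗ a comes out as multiplication by a, while a ⊗ 1 is
    absorbed into the form. *)
Lemma contract_mulU l x a : scalar l ->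
  contract l (x * << ucm a >>) =
  contract l x * << ucm a >> + contract (fun u => l (u * << ucm a >>)) x.
Proof.
move=> ll; rewrite /contract (algmorM (algmor_comul R A)) comul_ucm mulrDr.
rewrite [LHS](linear_addE _ _ (tens_lift_linear _)).
rewrite [X in X + _ = _](contract_tensM _ _ _ ll).
rewrite [X in _ + X = _](contract_tensM _ _ _ ll).
have [_ ml] := mul_bilinear R A.
move: (<< ucm a >> : H) => w; rewrite addrC.
have E : tens_lift (fun u v => l u *: v) (comul x) * w =
    tens_lift (fun u v => (l u *: v) * w) (comul x).
  exact: (linear_tens_lift _ _ (ml w)).
rewrite [X in _ = X + _]E; apply: (f_equal2 +%R).
  apply: eq_tens_lift => u v.
  by rewrite mulr1 -scalerAl.
apply: eq_tens_lift => u v.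
by rewrite mulr1.
Qed.

Lemma contract_top l m : scalar l ->
  deg_lt (mdeg m) (contract l << m >> - l 1 *: << m >>).
Proof.
move: m l; apply: cmonom_ind => [l ll|m a IHm l ll].
  have -> : contract l << mone >> = l 1 *: << mone >> by exact: contract1.
  by rewrite subrr => k _; rewrite mcoeff0.
rewrite -(malg_mulUU m (ucm a)) contract_mulU // mdegM mdegU addn1.
set l' := fun u => _; have ll' : scalar l' by exact: scalar_mulr.
(* The first term is the remainder for [l] at [m], raised one degree by the new letter. *)
rewrite addrAC scalerAl -mulrBl; apply: deg_ltD.
  exact: deg_lt_mulU (IHm _ ll).
(* The induction hypothesis for [l'] bounds this term by the degree of [m], already below that of
   [m a]; the value of [l' 1] does not matter. *)
rewrite -[contract l' _](subrK (l' 1 *: << m >>)); apply: deg_ltD.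
  exact: deg_ltW (IHm _ ll').
exact/deg_ltZ/deg_ltU.
Qed.

Section Lambda.
Context (lam : {scalar H}) (lam1 : lam 1 = 1).

Lemma phi_linear : linear (phi lam).
Proof. exact: contract_linear. Qed.

Lemma phi1 : phi lam 1 = 1.
Proof. by rewrite [LHS](contract1 (linearP lam)) lam1 scale1r. Qed.

Lemma phi_bijective :
  injective (phi lam) /\ (forall y, exists x, phi lam x = y).
Proof.
apply: unipotent_bijective => [|m]; first exact: phi_linear.
by have := contract_top (m := m) (linearP lam); rewrite lam1 scale1r.
Qed.

Lemma phiK : cancel (phi lam) (phi_inv lam).
Proof.
have [phi_inj _] := phi_bijective.
have injT : {in [set: H] &, injective (phi lam)}.
  by move=> x y _ _; exact: phi_inj.
by move=> x; exact: (pinvKV _ injT (in_setT x)).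
Qed.

Lemma phi_invK : cancel (phi_inv lam) (phi lam).
Proof.
have [_ phi_surj] := phi_bijective; move=> y.
have surjT : set_surj [set: H] [set: H] (phi lam).
  by move=> z _; have [x fx] := phi_surj z; exists x.
exact: (surjpK _ surjT (in_setT y)).
Qed.

(** Both sides are the sum of lam(x1) ε(x2): apply [lam] to the right counit axiom. *)
Lemma counit_phi x : counit (phi lam x) = lam x.
Proof.
have le : linear (@counit R A : H -> R^o) by exact: (@counit_scalar R A).
have ll : linear (lam : H -> R^o) by exact: linearP.
have lE : lam x =
    tens_lift (V := R^o) (fun u v => lam (counit v *: u)) (comul x).
  by rewrite -[in LHS](counitr_comul x); exact: (linear_tens_lift _ _ ll).
rewrite [RHS]lE; apply: etrans (linear_tens_lift _ _ le) _.
apply: eq_tens_lift => u v.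
rewrite [LHS](linear_scaleE _ _ le) [RHS](linear_scaleE _ _ ll).
exact: mulrC.
Qed.
End Lambda.
End Phi.

Theorem theorem5p1 (R : realType) (A : choiceType)
    (lam : {scalar {malg R[{cmonom A}]}}) (lam1 : lam 1 = 1) :
  [/\ is_hopf (hopfH_lam lam),
      forall x, counit_lam lam x = lam x
    & is_hopf_iso (hopfH R A) (hopfH_lam lam) (phi_inv lam)].
Proof.
have iso : is_hopf_iso (hopfH R A) (hopfH_lam lam) (phi_inv lam).
  (* Transport produces the unit [phi_inv lam 1]; the normalization of [lam] identifies it with
     [1]. *)
  have unitE : 1 = phi_inv lam 1.
    by have := phiK lam1 1; rewrite [X in phi_inv _ X](phi1 lam1).
  exact (transport_hopf_iso (B := hopfH R A) (C := hopfH_lam lam)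
    (phiK lam1) (phi_invK lam1) (phi_linear lam)
    (fun _ _ => erefl) unitE (fun=> erefl) (fun=> erefl) (hopfH_is_hopf R A)).
by split=> [|x|]; [exact: hopf_iso_codom iso | exact: counit_phi | exact: iso].
Qed.
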